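(* The reduction relation $\to_{\Lambda M}$ of the $\Lambda M$-calculus is confluent: for all $\Lambda M$-objects $o,o_0,o_1$ such that $o\twoheadrightarrow_{\Lambda M}o_0$ and $o\twoheadrightarrow_{\Lambda M}o_1$, there is a $\Lambda M$-object $o'$ such that $o_0\twoheadrightarrow_{\Lambda M}o'$ and $o_1\twoheadrightarrow_{\Lambda M}o'$, where $\twoheadrightarrow_{\Lambda M}$ is the reflexive-transitive closure of $\to_{\Lambda M}$.
   Context: **Syntax.** Fix countably infinite sets of variables $x,y,\dots$ and names $\alpha,\beta,\dots$. Terms $t,u,v::=x\mid t\,t\mid\lambda x.t\mid\mu\alpha.c\mid t[x\backslash t]$ (the last is an explicit substitution); commands $c::=[\alpha]t\mid c[\![\alpha\backslash^{\alpha'}s]\!]$ (the last is an explicit replacement); non-empty stacks $s::=t\mid t\cdot s$. The set $\mathbb{O}_{\Lambda M}$ of $\Lambda M$-objects consists of all terms, commands and stacks (a term is also a one-element stack). Binding: $\lambda x.t$ binds $x$ in $t$; $\mu\alpha.c$ binds $\alpha$ in $c$; $t[x\backslash u]$ binds $x$ in $t$ (not in $u$); $c[\![\alpha\backslash^{\alpha'}s]\!]$ binds $\alpha$ in $c$ (not in $s$), and the displayed $\alpha'$ is a free occurrence. Objects are identified modulo $\alpha$-conversion of bound variables and names (in particular, in $c[\![\alpha\backslash^{\alpha'}s]\!]$ one assumes $\alpha$ not free in $s$ and $\alpha\ne\alpha'$). $\mathsf{fn}_\alpha(c)$ is the number of free occurrences of $\alpha$ in $c$. $x\notin o$ (resp.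 $\alpha\notin o$) means that the variable (resp. name) occurs neither free nor bound in $o$; same for contexts. Concatenation of stacks: $(t_0\cdot\ldots\cdot t_n)\cdot s'=t_0\cdot\ldots\cdot t_n\cdot s'$. For a stack $s=t_0\cdot\ldots\cdot t_n$, $u::s$ is the term $u\,t_0\ldots t_n$. **Contexts.** $\mathtt T::=\Box\mid\mathtt T\,t\mid t\,\mathtt T\mid\lambda x.\mathtt T\mid\mu\alpha.\mathtt C\mid\mathtt T[x\backslash t]\mid t[x\backslash\mathtt T]$; $\mathtt C::=\boxdot\mid[\alpha]\mathtt T\mid\mathtt C[\![\alpha\backslash^{\alpha'}s]\!]\mid c[\![\alpha\backslash^{\alpha'}\mathtt S]\!]$; $\mathtt S::=\mathtt T\mid\mathtt T\cdot s\mid t\cdot\mathtt S$; $\mathtt O::=\mathtt T\mid\mathtt C\mid\mathtt S$. The hole $\Box$ is filled by terms, $\boxdot$ by commands; $\mathtt O\langle o\rangle$ is hole filling. Substitution contexts: $\mathtt L::=\Box\mid\mathtt L[x\backslash t]$. Linear contexts: $\mathtt{LTC}::=\mathtt{LTC}\,t\mid\lambda x.\mathtt{LTC}\mid\mu\alpha.\mathtt{LCC}\mid\mathtt{LTC}[x\backslash t]$; $\mathtt{LCC}::=\boxdot\mid[\alpha]\mathtt{LTC}\mid\mathtt{LCC}[\![\alpha\backslash^{\alpha'}s]\!]$. A command context with hole $\boxdot$ is non linear if it is not an $\mathtt{LCC}$. $\mathsf{fc}(o,\mathtt O)$ means that no free variable or name of $o$ is captured by binders of $\mathtt O$ in $\mathtt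 O\langle o\rangle$. **Implicit operations.** $o\{x\backslash u\}$ is capture-avoiding substitution of $u$ for $x$. The implicit replacement $o\{\!\{\alpha\backslash^{\alpha'}s\}\!\}$ (with $\alpha\ne\alpha'$, $\alpha$ not free in $s$) is the capture-avoiding operation commuting with all constructors except: $([\alpha]t)\{\!\{\alpha\backslash^{\alpha'}s\}\!\}=[\alpha']\big(t\{\!\{\alpha\backslash^{\alpha'}s\}\!\}::s\big)$ and $(c[\![\gamma\backslash^{\alpha}s']\!])\{\!\{\alpha\backslash^{\alpha'}s\}\!\}=(c\{\!\{\alpha\backslash^{\alpha'}s\}\!\})[\![\gamma\backslash^{\alpha'}\,s'\{\!\{\alpha\backslash^{\alpha'}s\}\!\}\cdot s]\!]$. **Reduction.** $\to_{\Lambda M}$ is the closure under all contexts $\mathtt O$ (with hole of the appropriate sort) of the rules: - (dB) $\mathtt L\langle\lambda x.t\rangle\,u\mapsto\mathtt L\langle t[x\backslash u]\rangle$, if $\mathsf{fc}(u,\mathtt L)$; - (S) $t[x\backslash u]\mapsto t\{x\backslash u\}$; - (dM) $\mathtt L\langle\mu\alpha.c\rangle\,u\mapsto\mathtt L\langle\mu\alpha'.c[\![\alpha\backslash^{\alpha'}u]\!]\rangle$, if $\mathsf{fc}(u,\mathtt L)$ and $\alpha'$ is fresh; - (N) $\mathtt{LCC}\langle[\alpha]t\rangle[\![\alpha\backslash^{\alpha'}s]\!]\mapsto\mathtt{LCC}\langle[\alpha'](t::s)\rangle$, if $\alpha\notin\mathtt{LCC}$, $\alpha\notin t$; - (C)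 $\mathtt{LCC}\langle c'[\![\beta\backslash^{\alpha}s']\!]\rangle[\![\alpha\backslash^{\alpha'}s]\!]\mapsto\mathtt{LCC}\langle c'[\![\beta\backslash^{\alpha'}s'\cdot s]\!]\rangle$, if $\alpha\notin\mathtt{LCC}$, $\alpha\notin c'$, $\alpha\notin s'$; - (Nnl), (Cnl): the same as (N), (C) respectively, but with $\mathtt{LCC}$ replaced by a non linear command context $\mathtt C$ with hole $\boxdot$; - (Rnl) $c[\![\alpha\backslash^{\alpha'}s]\!]\mapsto c\{\!\{\alpha\backslash^{\alpha'}s\}\!\}$, if $\mathsf{fn}_\alpha(c)\ne1$. In (N), (C), (Nnl), (Cnl), bound variables and names are chosen (by $\alpha$-conversion) so that $\alpha'$ and the free variables and names of $s$ are not captured on the right-hand side, by the context or (in (C), (Cnl)) by $[\![\beta\backslash\cdot]\!]$. *)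

(* Defs.v *)
From Stdlib Require Export Relation_Operators.
From mathcomp Require Export all_boot.

Set Implicit Arguments.
Unset Strict Implicit.
Unset Printing Implicit Defensive.

(* The Lambda-M-calculus.

   Objects modulo alpha-conversion are represented with de Bruijn indices, with
   two independent index spaces: one for variables (bound by [Lam] and [ESub])
   and one for names (bound by [Mu] and [ERepl]).  An index that exceeds the
   binders around it is free, so there are infinitely many free variables and
   free names. *)

Inductive term : Type :=
  | Var (x : nat)
  | App (t u : term)
  | Lam (t : term)                 (* binds variable 0 in t *)
  | Mu (c : command)               (* binds name 0 in c *)
  | ESub (t u : term)              (* t[x\u]: binds variable 0 in t, not in u *)
with command : Type :=
  | Named (a : nat) (t : term)     (* [a]t *)
  | ERepl (c : command) (a : nat) (s : stack)
      (* c[[alpha\^a s]]: binds name 0 (alpha) in c, not in a or s *)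
with stack : Type :=
  | SOne (t : term)
  | SCons (t : term) (s : stack).

(* A term, seen as an object, is a one-element stack. *)
Inductive obj : Type :=
  | OCmd (c : command)
  | OStack (s : stack).

Fixpoint scat (s s' : stack) : stack :=
  match s with
  | SOne t => SCons t s'
  | SCons t s0 => SCons t (scat s0 s')
  end.

(* u :: s, i.e. u t_0 ... t_n *)
Fixpoint app_stack (u : term) (s : stack) : term :=
  match s with
  | SOne t => App u t
  | SCons t s0 => app_stack (App u t) s0
  end.

(* Capture-avoiding renaming of free variables by f and free names by g. *)

Definition upr (f : nat -> nat) (i : nat) : nat :=
  if i is j.+1 then (f j).+1 else 0.

Fixpoint ren_t (f g : nat -> nat) (t : term) : term :=
  match t with
  | Var x => Var (f x)
  | App t u => App (ren_t f g t) (ren_t f g u)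
  | Lam t => Lam (ren_t (upr f) g t)
  | Mu c => Mu (ren_c f (upr g) c)
  | ESub t u => ESub (ren_t (upr f) g t) (ren_t f g u)
  end
with ren_c (f g : nat -> nat) (c : command) : command :=
  match c with
  | Named a t => Named (g a) (ren_t f g t)
  | ERepl c a s => ERepl (ren_c f (upr g) c) (g a) (ren_s f g s)
  end
with ren_s (f g : nat -> nat) (s : stack) : stack :=
  match s with
  | SOne t => SOne (ren_t f g t)
  | SCons t s => SCons (ren_t f g t) (ren_s f g s)
  end.

(* Weakening under m more variable binders and n more name binders. *)
Definition shift_t (m n : nat) : term -> term := ren_t (addn m) (addn n).
Definition shift_s (m n : nat) : stack -> stack := ren_s (addn m) (addn n).

(* Number of free occurrences of the name k. *)
Fixpoint fn_t (k : nat) (t : term) : nat :=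
  match t with
  | Var _ => 0
  | App t u => fn_t k t + fn_t k u
  | Lam t => fn_t k t
  | Mu c => fn_c k.+1 c
  | ESub t u => fn_t k t + fn_t k u
  end
with fn_c (k : nat) (c : command) : nat :=
  match c with
  | Named a t => (a == k) + fn_t k t
  | ERepl c a s => fn_c k.+1 c + (a == k) + fn_s k s
  end
with fn_s (k : nat) (s : stack) : nat :=
  match s with
  | SOne t => fn_t k t
  | SCons t s => fn_t k t + fn_s k s
  end.

(* Implicit substitution o{x\u}, where x is the variable k of o.  The binder of
   x disappears: u and the result live in the scope of o without x, whence
   [unbump k] on the other variables. *)
Fixpoint subst_t (k : nat) (u : term) (t : term) : term :=
  match t with
  | Var x => if x == k then u else Var (unbump k x)
  | App t1 t2 => App (subst_t k u t1) (subst_t k u t2)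
  | Lam t => Lam (subst_t k.+1 (shift_t 1 0 u) t)
  | Mu c => Mu (subst_c k (shift_t 0 1 u) c)
  | ESub t1 t2 => ESub (subst_t k.+1 (shift_t 1 0 u) t1) (subst_t k u t2)
  end
with subst_c (k : nat) (u : term) (c : command) : command :=
  match c with
  | Named a t => Named a (subst_t k u t)
  | ERepl c a s => ERepl (subst_c k (shift_t 0 1 u) c) a (subst_s k u s)
  end
with subst_s (k : nat) (u : term) (s : stack) : stack :=
  match s with
  | SOne t => SOne (subst_t k u t)
  | SCons t s => SCons (subst_t k u t) (subst_s k u s)
  end.

(* Implicit replacement o{{alpha\^a s}}, where alpha is the name k of o.  The
   binder of alpha disappears: a, s and the result live in the scope of o
   without alpha, which enforces that alpha differs from a and is not free in
   s. *)
Fixpoint repl_t (k a : nat) (s : stack) (t : term) : term :=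
  match t with
  | Var x => Var x
  | App t1 t2 => App (repl_t k a s t1) (repl_t k a s t2)
  | Lam t => Lam (repl_t k a (shift_s 1 0 s) t)
  | Mu c => Mu (repl_c k.+1 a.+1 (shift_s 0 1 s) c)
  | ESub t1 t2 => ESub (repl_t k a (shift_s 1 0 s) t1) (repl_t k a s t2)
  end
with repl_c (k a : nat) (s : stack) (c : command) : command :=
  match c with
  | Named b t =>
      if b == k then Named a (app_stack (repl_t k a s t) s)
      else Named (unbump k b) (repl_t k a s t)
  | ERepl c b s' =>
      let c1 := repl_c k.+1 a.+1 (shift_s 0 1 s) c in
      if b == k then ERepl c1 a (scat (repl_s k a s s') s)
      else ERepl c1 (unbump k b) (repl_s k a s s')
  end
with repl_s (k a : nat) (s : stack) (s' : stack) : stack :=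
  match s' with
  | SOne t => SOne (repl_t k a s t)
  | SCons t s0 => SCons (repl_t k a s t) (repl_s k a s s0)
  end.

(* One-hole contexts, indexed by the sort of their hole. *)

Inductive hole : Type := HTerm | HCmd.

Definition hole_type (h : hole) : Type :=
  match h with HTerm => term | HCmd => command end.

Inductive tctx : hole -> Type :=
  | TBox : tctx HTerm
  | TAppL h (T : tctx h) (t : term) : tctx h
  | TAppR h (t : term) (T : tctx h) : tctx h
  | TLam h (T : tctx h) : tctx h
  | TMu h (C : cctx h) : tctx h
  | TSubL h (T : tctx h) (t : term) : tctx h
  | TSubR h (t : term) (T : tctx h) : tctx h
with cctx : hole -> Type :=
  | CBox : cctx HCmd
  | CNamed h (a : nat) (T : tctx h) : cctx h
  | CReplL h (C : cctx h) (a : nat) (s : stack) : cctx h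
  | CReplR h (c : command) (a : nat) (K : sctx h) : cctx h
with sctx : hole -> Type :=
  | SCOne h (T : tctx h) : sctx h
  | SCHead h (T : tctx h) (s : stack) : sctx h
  | SCTail h (t : term) (K : sctx h) : sctx h.

Inductive octx : hole -> Type :=
  | OCCmd h (C : cctx h) : octx h
  | OCStack h (K : sctx h) : octx h.

(* Hole filling; it captures. *)
Fixpoint fill_t h (T : tctx h) : hole_type h -> term :=
  match T in tctx h return hole_type h -> term with
  | TBox => fun r => r
  | TAppL _ T t => fun r => App (fill_t T r) t
  | TAppR _ t T => fun r => App t (fill_t T r)
  | TLam _ T => fun r => Lam (fill_t T r)
  | TMu _ C => fun r => Mu (fill_c C r)
  | TSubL _ T t => fun r => ESub (fill_t T r) t
  | TSubR _ t T => fun r => ESub t (fill_t T r)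
  end
with fill_c h (C : cctx h) : hole_type h -> command :=
  match C in cctx h return hole_type h -> command with
  | CBox => fun r => r
  | CNamed _ a T => fun r => Named a (fill_t T r)
  | CReplL _ C a s => fun r => ERepl (fill_c C r) a s
  | CReplR _ c a K => fun r => ERepl c a (fill_s K r)
  end
with fill_s h (K : sctx h) : hole_type h -> stack :=
  match K in sctx h return hole_type h -> stack with
  | SCOne _ T => fun r => SOne (fill_t T r)
  | SCHead _ T s => fun r => SCons (fill_t T r) s
  | SCTail _ t K => fun r => SCons t (fill_s K r)
  end.

Definition fill_o h (O : octx h) : hole_type h -> obj :=
  match O in octx h return hole_type h -> obj with
  | OCCmd _ C => fun r => OCmd (fill_c C r)
  | OCStack _ K => fun r => OStack (fill_s K r)
  end.

(* Number of variable (vd) and name (nd) binders above the hole. *)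
Fixpoint vd_t h (T : tctx h) : nat :=
  match T with
  | TBox => 0
  | TAppL _ T _ | TAppR _ _ T | TSubR _ _ T => vd_t T
  | TLam _ T | TSubL _ T _ => (vd_t T).+1
  | TMu _ C => vd_c C
  end
with vd_c h (C : cctx h) : nat :=
  match C with
  | CBox => 0
  | CNamed _ _ T => vd_t T
  | CReplL _ C _ _ => vd_c C
  | CReplR _ _ _ K => vd_s K
  end
with vd_s h (K : sctx h) : nat :=
  match K with
  | SCOne _ T | SCHead _ T _ => vd_t T
  | SCTail _ _ K => vd_s K
  end.

Fixpoint nd_t h (T : tctx h) : nat :=
  match T with
  | TBox => 0
  | TAppL _ T _ | TAppR _ _ T | TLam _ T | TSubL _ T _ | TSubR _ _ T => nd_t T
  | TMu _ C => (nd_c C).+1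
  end
with nd_c h (C : cctx h) : nat :=
  match C with
  | CBox => 0
  | CNamed _ _ T => nd_t T
  | CReplL _ C _ _ => (nd_c C).+1
  | CReplR _ _ _ K => nd_s K
  end
with nd_s h (K : sctx h) : nat :=
  match K with
  | SCOne _ T | SCHead _ T _ => nd_t T
  | SCTail _ _ K => nd_s K
  end.

Fixpoint ren_tctx (f g : nat -> nat) h (T : tctx h) : tctx h :=
  match T in tctx h return tctx h with
  | TBox => TBox
  | TAppL _ T t => TAppL (ren_tctx f g T) (ren_t f g t)
  | TAppR _ t T => TAppR (ren_t f g t) (ren_tctx f g T)
  | TLam _ T => TLam (ren_tctx (upr f) g T)
  | TMu _ C => TMu (ren_cctx f (upr g) C)
  | TSubL _ T t => TSubL (ren_tctx (upr f) g T) (ren_t f g t)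
  | TSubR _ t T => TSubR (ren_t (upr f) g t) (ren_tctx f g T)
  end
with ren_cctx (f g : nat -> nat) h (C : cctx h) : cctx h :=
  match C in cctx h return cctx h with
  | CBox => CBox
  | CNamed _ a T => CNamed (g a) (ren_tctx f g T)
  | CReplL _ C a s => CReplL (ren_cctx f (upr g) C) (g a) (ren_s f g s)
  | CReplR _ c a K => CReplR (ren_c f (upr g) c) (g a) (ren_sctx f g K)
  end
with ren_sctx (f g : nat -> nat) h (K : sctx h) : sctx h :=
  match K in sctx h return sctx h with
  | SCOne _ T => SCOne (ren_tctx f g T)
  | SCHead _ T s => SCHead (ren_tctx f g T) (ren_s f g s)
  | SCTail _ t K => SCTail (ren_t f g t) (ren_sctx f g K)
  end.

(* Substitution contexts L ::= Box | L[x\t]. *)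
Fixpoint is_subst_ctx h (T : tctx h) : bool :=
  match T with
  | TBox => true
  | TSubL _ T _ => is_subst_ctx T
  | _ => false
  end.

(* Linear contexts LTC and LCC; their hole is always a command hole. *)
Fixpoint is_ltc h (T : tctx h) : bool :=
  match T with
  | TAppL _ T _ | TLam _ T | TSubL _ T _ => is_ltc T
  | TMu _ C => is_lcc C
  | _ => false
  end
with is_lcc h (C : cctx h) : bool :=
  match C with
  | CBox => true
  | CNamed _ _ T => is_ltc T
  | CReplL _ C _ _ => is_lcc C
  | CReplR _ _ _ _ => false
  end.

(* Conventions in the rules below.
   - The non-capture conditions amount to weakening what enters a context L or
     C by the binders above the hole.
   - In the rules N, C, Nnl and Cnl, the erased binder alpha has index 0 outside
     the context C and nd_c C at its hole.  The hypothesis that alpha does not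
     occur in an object or context is expressed by taking the latter in the
     scope without alpha and weakening it on the left-hand side by [bump j],
     the injection of nat that misses exactly the index j of alpha. *)

Definition N_lhs (C : cctx HCmd) (t : term) (a : nat) (s : stack) : command :=
  let n := nd_c C in
  ERepl (fill_c (ren_cctx id (bump 0) C) (Named n (ren_t id (bump n) t))) a s.

Definition N_rhs (C : cctx HCmd) (t : term) (a : nat) (s : stack) : command :=
  let n := nd_c C in
  fill_c C (Named (n + a) (app_stack t (shift_s (vd_c C) n s))).

(* In c' the name 0 is beta, hence alpha has index (nd_c C).+1 there. *)
Definition C_lhs (C : cctx HCmd) (c' : command) (s' : stack)
    (a : nat) (s : stack) : command :=
  let n := nd_c C in
  ERepl (fill_c (ren_cctx id (bump 0) C)
           (ERepl (ren_c id (bump n.+1) c') n (ren_s id (bump n) s'))) a s.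

Definition C_rhs (C : cctx HCmd) (c' : command) (s' : stack)
    (a : nat) (s : stack) : command :=
  let n := nd_c C in
  fill_c C (ERepl c' (n + a) (scat s' (shift_s (vd_c C) n s))).

Inductive root_t : term -> term -> Prop :=
  | R_dB (L : tctx HTerm) (t u : term) :
      is_subst_ctx L ->
      root_t (App (fill_t L (Lam t)) u)
             (fill_t L (ESub t (shift_t (vd_t L) 0 u)))
  | R_S (t u : term) : root_t (ESub t u) (subst_t 0 u t)
  (* On the right-hand side, c lies under the new binder alpha' (name 1) and
     under alpha (name 0); u lies under alpha' only. *)
  | R_dM (L : tctx HTerm) (c : command) (u : term) :
      is_subst_ctx L ->
      root_t (App (fill_t L (Mu c)) u)
             (fill_t L (Mu (ERepl (ren_c id (bump 1) c) 0
                                  (SOne (shift_t (vd_t L) 1 u))))).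

Inductive root_c : command -> command -> Prop :=
  | R_N (C : cctx HCmd) t a s : is_lcc C -> root_c (N_lhs C t a s) (N_rhs C t a s)
  | R_C (C : cctx HCmd) c' s' a s :
      is_lcc C -> root_c (C_lhs C c' s' a s) (C_rhs C c' s' a s)
  | R_Nnl (C : cctx HCmd) t a s :
      ~~ is_lcc C -> root_c (N_lhs C t a s) (N_rhs C t a s)
  | R_Cnl (C : cctx HCmd) c' s' a s :
      ~~ is_lcc C -> root_c (C_lhs C c' s' a s) (C_rhs C c' s' a s)
  | R_Rnl (c : command) a s :
      fn_c 0 c <> 1 -> root_c (ERepl c a s) (repl_c 0 a s c).

Definition root (h : hole) : hole_type h -> hole_type h -> Prop :=
  match h with HTerm => root_t | HCmd => root_c end.

Inductive step : obj -> obj -> Prop :=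
  | Step h (O : octx h) (r r' : hole_type h) :
      root r r' -> step (fill_o O r) (fill_o O r').

Definition steps : obj -> obj -> Prop := clos_refl_trans obj step.

(* Main.v *)
(** The rules N, C, Nnl, Cnl and Rnl together allow any explicit replacement to
    be executed: if its name occurs exactly once, in a context C, then N or C
    performs precisely the implicit replacement, and otherwise Rnl applies.
    Interpret an object by its unfolding, in which all explicit substitutions
    and replacements are executed.  An object reduces to its unfolding, steps
    dB and dM become beta- and mu-steps between unfoldings (at a distance
    disappears, as a substitution context unfolds to a substitution), and the
    other rules preserve the unfolding.  Beta and mu are simulated by dB;S and
    dM;R, and they are confluent by the Tait--Martin-Loef method with Takahashi's
    complete developments; hence so is the whole reduction. *)
Require Import Defs.
From Stdlib Require Import FunctionalExtensionality.

Set Implicit Arguments.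
Unset Strict Implicit.
Unset Printing Implicit Defensive.

Scheme term_mut := Induction for term Sort Prop
  with command_mut := Induction for command Sort Prop
  with stack_mut := Induction for stack Sort Prop.
Combined Scheme syntax_ind from term_mut, command_mut, stack_mut.

Ltac rewrite_hyps := repeat match goal with H : _ |- _ => rewrite H end.

(** * Stacks as non-empty lists of terms *)

Fixpoint seq_of (s : stack) : seq term :=
  match s with
  | SOne t => [:: t]
  | SCons t s => t :: seq_of s
  end.

Fixpoint stack_of (t : term) (l : seq term) : stack :=
  if l is u :: l' then SCons t (stack_of u l') else SOne t.

(** The right operand may be empty, which a stack cannot be: a name left alone by a simultaneous
    replacement pushes nothing. *)
Fixpoint scat_seq (s : stack) (l : seq term) : stack :=
  match s with
  | SOne t => stack_of t l
  | SCons t s => SCons t (scat_seq s l)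
  end.

Lemma seq_of_stack_of t l : seq_of (stack_of t l) = t :: l.
Proof. by elim: l t => //= u l IH t; rewrite IH. Qed.

Lemma scat_seq0 s : scat_seq s [::] = s.
Proof. by elim: s => //= t s ->. Qed.

Lemma seq_of_inj : injective seq_of.
Proof.
elim=> [t|t s IH] [u|u s'] //=; first by case=> ->.
- by case: s'.
- by case: s {IH}.
by case=> -> /IH ->.
Qed.

Lemma seq_of_scat_seq s l : seq_of (scat_seq s l) = seq_of s ++ l.
Proof. by elim: s => [t|t s IH] /=; rewrite ?seq_of_stack_of ?IH. Qed.

Lemma scatE s s' : scat s s' = scat_seq s (seq_of s').
Proof.
apply: seq_of_inj; rewrite seq_of_scat_seq.
by elim: s => //= t s ->.
Qed.

Lemma app_stackE u s : app_stack u s = foldl App u (seq_of s).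
Proof. by elim: s u => //= t s IH u; rewrite IH. Qed.

Lemma seq_of_ren f g s : seq_of (ren_s f g s) = map (ren_t f g) (seq_of s).
Proof. by elim: s => //= t s ->. Qed.

(** * Simultaneous renaming, substitution and replacement *)

Lemma upr_id : upr id = id.
Proof. by apply: functional_extensionality => -[]. Qed.

Lemma upr_comp f f' : upr f \o upr f' = upr (f \o f').
Proof. by apply: functional_extensionality => -[]. Qed.

Lemma ren_comp :
  (forall t f g f' g', ren_t f' g' (ren_t f g t) = ren_t (f' \o f) (g' \o g) t) /\
  (forall c f g f' g', ren_c f' g' (ren_c f g c) = ren_c (f' \o f) (g' \o g) c) /\
  (forall s f g f' g', ren_s f' g' (ren_s f g s) = ren_s (f' \o f) (g' \o g) s).
Proof.
apply: syntax_ind => /= *; rewrite_hyps; by rewrite ?upr_comp.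
Qed.

(* A name is mapped to a name together with the stack, empty or not, that is to
   be pushed at its occurrences; renaming, substitution and replacement are then
   all instances of one simultaneous operation. *)
Definition lift_vv (sg : nat -> term) (x : nat) : term :=
  if x is y.+1 then shift_t 1 0 (sg y) else Var 0.
(** In these names the first letter is the binder crossed, variable or name, and the second is the
    kind of map that crosses it. *)
Definition lift_vn (rh : nat -> nat * seq term) (a : nat) : nat * seq term :=
  ((rh a).1, map (shift_t 1 0) (rh a).2).
Definition lift_nv (sg : nat -> term) (x : nat) : term := shift_t 0 1 (sg x).
Definition lift_nn (rh : nat -> nat * seq term) (a : nat) : nat * seq term :=
  if a is b.+1 then ((rh b).1.+1, map (shift_t 0 1) (rh b).2) else (0, [::]).

Fixpoint inst_t sg rh (t : term) : term :=
  match t with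
  | Var x => sg x
  | App t u => App (inst_t sg rh t) (inst_t sg rh u)
  | Lam t => Lam (inst_t (lift_vv sg) (lift_vn rh) t)
  | Mu c => Mu (inst_c (lift_nv sg) (lift_nn rh) c)
  | ESub t u => ESub (inst_t (lift_vv sg) (lift_vn rh) t) (inst_t sg rh u)
  end
with inst_c sg rh (c : command) : command :=
  match c with
  | Named a t => Named (rh a).1 (foldl App (inst_t sg rh t) (rh a).2)
  | ERepl c a s =>
      ERepl (inst_c (lift_nv sg) (lift_nn rh) c) (rh a).1
            (scat_seq (inst_s sg rh s) (rh a).2)
  end
with inst_s sg rh (s : stack) : stack :=
  match s with
  | SOne t => SOne (inst_t sg rh t)
  | SCons t s => SCons (inst_t sg rh t) (inst_s sg rh s)
  end.

Lemma seq_of_inst sg rh s : seq_of (inst_s sg rh s) = map (inst_t sg rh) (seq_of s).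
Proof. by elim: s => //= t s ->. Qed.

Definition vren (f : nat -> nat) (x : nat) : term := Var (f x).
Definition nren (g : nat -> nat) (a : nat) : nat * seq term := (g a, [::]).

Lemma lift_vv_ren f : lift_vv (vren f) = vren (upr f).
Proof. by apply: functional_extensionality => -[]. Qed.

Lemma lift_nn_ren g : lift_nn (nren g) = nren (upr g).
Proof. by apply: functional_extensionality => -[]. Qed.

Lemma ren_inst :
  (forall t f g, ren_t f g t = inst_t (vren f) (nren g) t) /\
  (forall c f g, ren_c f g c = inst_c (vren f) (nren g) c) /\
  (forall s f g, ren_s f g s = inst_s (vren f) (nren g) s).
Proof.
apply: syntax_ind => /= *; rewrite_hyps; by rewrite ?lift_vv_ren ?lift_nn_ren ?scat_seq0.
Qed.

Lemma inst_ren :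
  (forall t f g sg rh, inst_t sg rh (ren_t f g t) = inst_t (sg \o f) (rh \o g) t) /\
  (forall c f g sg rh, inst_c sg rh (ren_c f g c) = inst_c (sg \o f) (rh \o g) c) /\
  (forall s f g sg rh, inst_s sg rh (ren_s f g s) = inst_s (sg \o f) (rh \o g) s).
Proof.
have Hv sg f : lift_vv sg \o upr f = lift_vv (sg \o f).
  by apply: functional_extensionality => -[].
have Hn rh f : lift_nn rh \o upr f = lift_nn (rh \o f).
  by apply: functional_extensionality => -[].
apply: syntax_ind => /= *; rewrite_hyps; by rewrite ?Hv ?Hn.
Qed.

Definition comp_vv sg rh (sg0 : nat -> term) (x : nat) : term := inst_t sg rh (sg0 x).
(** Terms pushed by [rh0] are instantiated and stay nearest to the head; those that [rh] pushes at
    the new name come behind them. *)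
Definition comp_nn sg rh (rh0 : nat -> nat * seq term) (a : nat) : nat * seq term :=
  ((rh (rh0 a).1).1, map (inst_t sg rh) (rh0 a).2 ++ (rh (rh0 a).1).2).

Lemma inst_foldl sg rh t l :
  inst_t sg rh (foldl App t l) = foldl App (inst_t sg rh t) (map (inst_t sg rh) l).
Proof. by elim: l t => //= u l IH t; rewrite IH. Qed.

Definition lift_compat (ap : (nat -> term) -> (nat -> nat * seq term) -> Prop) :=
  (forall sg rh, ap sg rh -> ap (lift_vv sg) (lift_vn rh)) /\
  (forall sg rh, ap sg rh -> ap (lift_nv sg) (lift_nn rh)).

(* [ap] is instantiated first with renamings, then with everything. *)
Lemma inst_comp_gen (ap : (nat -> term) -> (nat -> nat * seq term) -> Prop) :
  lift_compat ap ->
  (forall sg rh, ap sg rh -> forall t,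
     inst_t (lift_vv sg) (lift_vn rh) (shift_t 1 0 t) = shift_t 1 0 (inst_t sg rh t)) ->
  (forall sg rh, ap sg rh -> forall t,
     inst_t (lift_nv sg) (lift_nn rh) (shift_t 0 1 t) = shift_t 0 1 (inst_t sg rh t)) ->
  (forall t sg rh sg0 rh0, ap sg rh -> inst_t sg rh (inst_t sg0 rh0 t)
     = inst_t (comp_vv sg rh sg0) (comp_nn sg rh rh0) t) /\
  (forall c sg rh sg0 rh0, ap sg rh -> inst_c sg rh (inst_c sg0 rh0 c)
     = inst_c (comp_vv sg rh sg0) (comp_nn sg rh rh0) c) /\
  (forall s sg rh sg0 rh0, ap sg rh -> inst_s sg rh (inst_s sg0 rh0 s)
     = inst_s (comp_vv sg rh sg0) (comp_nn sg rh rh0) s).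
Proof.
move=> [apv apn] Hv Hn.
have lvv sg rh sg0 : ap sg rh ->
    comp_vv (lift_vv sg) (lift_vn rh) (lift_vv sg0) = lift_vv (comp_vv sg rh sg0).
  by move=> H; apply: functional_extensionality => -[|x] //=; rewrite /comp_vv /= Hv.
have lvn sg rh rh0 : ap sg rh ->
    comp_nn (lift_vv sg) (lift_vn rh) (lift_vn rh0) = lift_vn (comp_nn sg rh rh0).
  move=> H; apply: functional_extensionality => a; rewrite /comp_nn /lift_vn /=.
  by rewrite map_cat -!map_comp; congr (_, _ ++ _); apply: eq_map => t /=; rewrite Hv.
have lnv sg rh sg0 : ap sg rh ->
    comp_vv (lift_nv sg) (lift_nn rh) (lift_nv sg0) = lift_nv (comp_vv sg rh sg0).
  by move=> H; apply: functional_extensionality => x; rewrite /comp_vv /lift_nv Hn.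
have lnn sg rh rh0 : ap sg rh ->
    comp_nn (lift_nv sg) (lift_nn rh) (lift_nn rh0) = lift_nn (comp_nn sg rh rh0).
  move=> H; apply: functional_extensionality => -[|a] //; rewrite /comp_nn /=.
  by rewrite map_cat -!map_comp; congr (_, _ ++ _); apply: eq_map => t /=; rewrite Hn.
apply: syntax_ind => //=.
- by move=> *; f_equal; auto.
- by move=> t IH sg rh sg0 rh0 H; rewrite IH ?lvv ?lvn; auto.
- by move=> c IH sg rh sg0 rh0 H; rewrite IH ?lnv ?lnn; auto.
- by move=> t IH u IHu sg rh sg0 rh0 H; rewrite IH ?IHu ?lvv ?lvn; auto.
- by move=> a t IH sg rh sg0 rh0 H; rewrite inst_foldl IH // foldl_cat.
- move=> c IH a s IHs sg rh sg0 rh0 H; rewrite IH ?lnv ?lnn; auto; congr ERepl.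
  have /(congr1 seq_of) := IHs _ _ sg0 rh0 H; rewrite !seq_of_inst => Es.
  by apply: seq_of_inj; rewrite !(seq_of_scat_seq, seq_of_inst) map_cat -catA Es.
- by move=> *; f_equal; auto.
- by move=> *; f_equal; auto.
Qed.

(** The composition law requires lifting to commute with weakening. When the outer maps are
    renamings this is just composition of renamings, and the resulting instance of the law settles
    the requirement for arbitrary maps. *)
Lemma ren_inst_comm :
  (forall t f g sg rh, ren_t f g (inst_t sg rh t)
     = inst_t (ren_t f g \o sg) (fun a => (g (rh a).1, map (ren_t f g) (rh a).2)) t) /\
  (forall c f g sg rh, ren_c f g (inst_c sg rh c)
     = inst_c (ren_t f g \o sg) (fun a => (g (rh a).1, map (ren_t f g) (rh a).2)) c).
Proof.
pose ap sg rh := exists f g, sg = vren f /\ rh = nren g.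
have lift_ap : lift_compat ap.
  split=> _ _ [f] [g] [-> ->].
    by exists (upr f), g; rewrite lift_vv_ren.
  by exists f, (upr g); rewrite lift_nn_ren.
have [||Ht [Hc _]] := inst_comp_gen lift_ap.
- move=> _ _ [f] [g] [-> ->] t; rewrite lift_vv_ren -!ren_inst.1 /shift_t !ren_comp.1.
  reflexivity.
- move=> _ _ [f] [g] [-> ->] t; rewrite lift_nn_ren -!ren_inst.1 /shift_t !ren_comp.1.
  reflexivity.
have Hv f g sg : comp_vv (vren f) (nren g) sg = ren_t f g \o sg.
  by apply: functional_extensionality => x; rewrite /comp_vv -ren_inst.1.
have Hn f g rh : comp_nn (vren f) (nren g) rh
    = (fun a => (g (rh a).1, map (ren_t f g) (rh a).2)).
  apply: functional_extensionality => a; rewrite /comp_nn cats0.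
  by congr (_, _); apply: eq_map => t; rewrite -ren_inst.1.
split=> [t|c] f g sg rh.
  by rewrite ren_inst.1 Ht ?Hv ?Hn //; exists f, g.
by rewrite ren_inst.2.1 Hc ?Hv ?Hn //; exists f, g.
Qed.

Lemma inst_comp :
  (forall t sg rh sg0 rh0, inst_t sg rh (inst_t sg0 rh0 t)
     = inst_t (comp_vv sg rh sg0) (comp_nn sg rh rh0) t) /\
  (forall c sg rh sg0 rh0, inst_c sg rh (inst_c sg0 rh0 c)
     = inst_c (comp_vv sg rh sg0) (comp_nn sg rh rh0) c) /\
  (forall s sg rh sg0 rh0, inst_s sg rh (inst_s sg0 rh0 s)
     = inst_s (comp_vv sg rh sg0) (comp_nn sg rh rh0) s).
Proof.
have [|||Ht [Hc Hs]] := @inst_comp_gen (fun _ _ => True).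
- by [].
- move=> sg rh _ t; rewrite [LHS]inst_ren.1 [RHS]ren_inst_comm.1.
  reflexivity.
- move=> sg rh _ t; rewrite [LHS]inst_ren.1 [RHS]ren_inst_comm.1.
  reflexivity.
by split; [|split] => *; [apply: Ht|apply: Hc|apply: Hs].
Qed.
Lemma ren_id :
  (forall t, ren_t id id t = t) /\ (forall c, ren_c id id c = c) /\
  (forall s, ren_s id id s = s).
Proof. by apply: syntax_ind => /= *; rewrite ?upr_id; rewrite_hyps. Qed.

Lemma inst_id :
  (forall t, inst_t Var (nren id) t = t) /\ (forall c, inst_c Var (nren id) c = c) /\
  (forall s, inst_s Var (nren id) s = s).
Proof.
split; [|split] => [t|c|s]; first by rewrite -[RHS]ren_id.1 ren_inst.1.
  by rewrite -[RHS]ren_id.2.1 ren_inst.2.1.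
by rewrite -[RHS]ren_id.2.2 ren_inst.2.2.
Qed.

Definition vsubst (k : nat) (u : term) (x : nat) : term :=
  if x == k then u else Var (unbump k x).
Definition nrepl (k a : nat) (l : seq term) (b : nat) : nat * seq term :=
  if b == k then (a, l) else (unbump k b, [::]).

Lemma lift_vv_subst k u : lift_vv (vsubst k u) = vsubst k.+1 (shift_t 1 0 u).
Proof.
apply: functional_extensionality => -[|x] //=; rewrite /vsubst eqSS unbumpS.
by case: eqP.
Qed.

Lemma lift_nv_subst k u : lift_nv (vsubst k u) = vsubst k (shift_t 0 1 u).
Proof. by apply: functional_extensionality => x; rewrite /vsubst /lift_nv; case: eqP. Qed.

Lemma lift_vn_repl k a s :
  lift_vn (nrepl k a (seq_of s)) = nrepl k a (seq_of (shift_s 1 0 s)).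
Proof.
apply: functional_extensionality => x; rewrite /nrepl /lift_vn /shift_s seq_of_ren.
by case: eqP.
Qed.

Lemma lift_nn_repl k a s :
  lift_nn (nrepl k a (seq_of s)) = nrepl k.+1 a.+1 (seq_of (shift_s 0 1 s)).
Proof.
apply: functional_extensionality => -[|x] //=.
by rewrite /nrepl eqSS unbumpS /shift_s seq_of_ren; case: eqP.
Qed.

Lemma lift_nn_id : lift_nn (nren id) = nren id.
Proof. by rewrite lift_nn_ren upr_id. Qed.

Lemma lift_vv_id : lift_vv Var = Var.
Proof. by apply: functional_extensionality => -[]. Qed.

Lemma subst_inst :
  (forall t k u, subst_t k u t = inst_t (vsubst k u) (nren id) t) /\
  (forall c k u, subst_c k u c = inst_c (vsubst k u) (nren id) c) /\
  (forall s k u, subst_s k u s = inst_s (vsubst k u) (nren id) s).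
Proof.
apply: syntax_ind => //= *; rewrite ?lift_vv_subst ?lift_nv_subst ?lift_nn_id ?scat_seq0.
all: by rewrite_hyps.
Qed.

Lemma repl_inst :
  (forall t k a s, repl_t k a s t = inst_t Var (nrepl k a (seq_of s)) t) /\
  (forall c k a s, repl_c k a s c = inst_c Var (nrepl k a (seq_of s)) c) /\
  (forall s' k a s, repl_s k a s s' = inst_s Var (nrepl k a (seq_of s)) s').
Proof.
apply: syntax_ind => //= *.
all: rewrite ?lift_vv_id ?lift_vn_repl ?lift_nn_repl; rewrite_hyps => //.
- by rewrite /nrepl; case: eqP => // _; rewrite app_stackE.
- by rewrite /nrepl; case: eqP => // _; rewrite ?scatE ?scat_seq0.
Qed.

(** By [inst_comp] both sides are single instantiations. Their maps agree because substituting for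
    variable 0 undoes the weakening introduced by lifting. *)
Lemma inst_subst sg rh u t :
  inst_t sg rh (subst_t 0 u t)
  = subst_t 0 (inst_t sg rh u) (inst_t (lift_vv sg) (lift_vn rh) t).
Proof.
have E v t' : inst_t (vsubst 0 v) (nren id) (shift_t 1 0 t') = t'.
  rewrite /shift_t inst_ren.1 -[RHS]inst_id.1; congr inst_t.
  by apply: functional_extensionality => y; rewrite /vsubst /= /unbump subn1.
rewrite !subst_inst.1 !inst_comp.1; congr inst_t; apply: functional_extensionality.
- case=> [|x] //=; rewrite /comp_vv /vsubst /= E /unbump.
  by rewrite subn1.
- move=> a; rewrite /comp_nn /= cats0 -map_comp; case: (rh a) => b l; congr (_, _).
  by rewrite -[LHS]map_id; apply: eq_map => t' /=; rewrite E.
Qed.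

(** The image of [bump k] misses [k], so the replacement meets no occurrence and only undoes the
    renumbering. *)
Lemma repl_shift :
  (forall t k a s, repl_t k a s (ren_t id (bump k) t) = t) /\
  (forall c k a s, repl_c k a s (ren_c id (bump k) c) = c) /\
  (forall s' k a s, repl_s k a s (ren_s id (bump k) s') = s').
Proof.
have E k a l : nrepl k a l \o bump k = nren id.
  apply: functional_extensionality => b.
  by rewrite /= /nrepl eq_sym (negbTE (neq_bump _ _)) bumpK.
split; [|split] => [t|c|s'] k a s.
- by rewrite repl_inst.1 inst_ren.1 E -[RHS]inst_id.1.
- by rewrite repl_inst.2.1 inst_ren.2.1 E -[RHS]inst_id.2.1.
- by rewrite repl_inst.2.2 inst_ren.2.2 E -[RHS]inst_id.2.2.
Qed.

(** Occurrences redirected to [a] are then subject to [rh], which pushes its terms behind [s]; hence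
    the appended [(rh a).2]. *)
Lemma inst_repl sg rh a s c :
  inst_c sg rh (repl_c 0 a s c)
  = repl_c 0 (rh a).1 (scat_seq (inst_s sg rh s) (rh a).2)
      (inst_c (lift_nv sg) (lift_nn rh) c).
Proof.
have E a' s' t : inst_t Var (nrepl 0 a' (seq_of s')) (shift_t 0 1 t) = t.
  by rewrite -[RHS](repl_shift.1 t 0 a' s') repl_inst.1.
rewrite !repl_inst.2.1 !inst_comp.2.1; congr inst_c; apply: functional_extensionality.
- by move=> x; rewrite /comp_vv /lift_nv E.
- case=> [|b].
    by rewrite /comp_nn /= !seq_of_scat_seq !seq_of_inst.
  rewrite /comp_nn /= /unbump subn1 /=; case: (rh b) => b' l /=.
  rewrite /nrepl /unbump /= subn1 cats0 -map_comp; congr (_, _).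
  by rewrite -[LHS]map_id; apply: eq_map => t /=; rewrite E.
Qed.

(* The body of the reduct of [App (Mu c) u]. *)
Definition mu_repl (u : term) (c : command) : command :=
  repl_c 0 0 (SOne (shift_t 0 1 u)) (ren_c id (bump 1) c).

(** The fresh name takes over index 0 from the erased one, so no name changes and [u] is merely
    pushed at name 0. *)
Lemma mu_repl_inst u c :
  mu_repl u c
  = inst_c Var (fun a => (a, if a == 0 then [:: shift_t 0 1 u] else [::])) c.
Proof.
rewrite /mu_repl repl_inst.2.1 inst_ren.2.1; congr inst_c.
by apply: functional_extensionality => -[|a].
Qed.

Lemma inst_mu_repl sg rh u c :
  inst_c (lift_nv sg) (lift_nn rh) (mu_repl u c)
  = mu_repl (inst_t sg rh u) (inst_c (lift_nv sg) (lift_nn rh) c).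
Proof.
(* A map that affects name 0 only is invisible to terms avoiding that name. *)
have E rh' t : (forall a, rh' a.+1 = (a.+1, [::])) ->
    inst_t Var rh' (shift_t 0 1 t) = shift_t 0 1 t.
  move=> H; rewrite /shift_t inst_ren.1 ren_inst.1; congr inst_t.
  by apply: functional_extensionality => a /=; rewrite H.
rewrite !mu_repl_inst !inst_comp.2.1; congr inst_c; apply: functional_extensionality.
- by move=> x; rewrite /comp_vv /lift_nv E.
- case=> [|a] /=; rewrite /comp_nn /=.
    by congr (_, [:: _]); rewrite [LHS]inst_ren.1 [RHS]ren_inst_comm.1.
  by rewrite cats0; congr (_, _); rewrite -map_comp; apply: eq_map => t /=; rewrite E.
Qed.

(** * Unfolding explicit operators *)

Fixpoint unf_t (t : term) : term :=
  match t with
  | Var x => Var x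
  | App t u => App (unf_t t) (unf_t u)
  | Lam t => Lam (unf_t t)
  | Mu c => Mu (unf_c c)
  | ESub t u => subst_t 0 (unf_t u) (unf_t t)
  end
with unf_c (c : command) : command :=
  match c with
  | Named a t => Named a (unf_t t)
  | ERepl c a s => repl_c 0 a (unf_s s) (unf_c c)
  end
with unf_s (s : stack) : stack :=
  match s with
  | SOne t => SOne (unf_t t)
  | SCons t s => SCons (unf_t t) (unf_s s)
  end.

Definition unf_v (sg : nat -> term) (x : nat) : term := unf_t (sg x).
Definition unf_n (rh : nat -> nat * seq term) (a : nat) : nat * seq term :=
  ((rh a).1, map unf_t (rh a).2).

Lemma unf_foldl t l : unf_t (foldl App t l) = foldl App (unf_t t) (map unf_t l).
Proof. by elim: l t => //= u l IH t; rewrite IH. Qed.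

Lemma seq_of_unf s : seq_of (unf_s s) = map unf_t (seq_of s).
Proof. by elim: s => //= t s ->. Qed.

Lemma unf_scat_seq s l : unf_s (scat_seq s l) = scat_seq (unf_s s) (map unf_t l).
Proof. by apply: seq_of_inj; rewrite !(seq_of_unf, seq_of_scat_seq) map_cat. Qed.

(** Explicit operators are handled by [inst_subst] and [inst_repl]. As with composition, [ap] first
    consists of renamings: lifting weakens, so unfolding must commute with renaming before it can
    commute with lifting in general. *)
Lemma unf_inst_gen (ap : (nat -> term) -> (nat -> nat * seq term) -> Prop) :
  (forall sg rh, ap sg rh -> ap (lift_vv sg) (lift_vn rh) /\
     unf_v (lift_vv sg) = lift_vv (unf_v sg) /\ unf_n (lift_vn rh) = lift_vn (unf_n rh)) ->
  (forall sg rh, ap sg rh -> ap (lift_nv sg) (lift_nn rh) /\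
     unf_v (lift_nv sg) = lift_nv (unf_v sg) /\ unf_n (lift_nn rh) = lift_nn (unf_n rh)) ->
  (forall t sg rh, ap sg rh -> unf_t (inst_t sg rh t) = inst_t (unf_v sg) (unf_n rh) (unf_t t)) /\
  (forall c sg rh, ap sg rh -> unf_c (inst_c sg rh c) = inst_c (unf_v sg) (unf_n rh) (unf_c c)) /\
  (forall s sg rh, ap sg rh -> unf_s (inst_s sg rh s) = inst_s (unf_v sg) (unf_n rh) (unf_s s)).
Proof.
move=> Hv Hn; apply: syntax_ind => //=.
- by move=> t IH u IHu sg rh H; rewrite IH ?IHu.
- by move=> t IH sg rh H; have [H' [E1 E2]] := Hv _ _ H; rewrite IH // E1 E2.
- by move=> c IH sg rh H; have [H' [E1 E2]] := Hn _ _ H; rewrite IH // E1 E2.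
- move=> t IH u IHu sg rh H; have [H' [E1 E2]] := Hv _ _ H.
  by rewrite IH // E1 E2 IHu // inst_subst.
- by move=> a t IH sg rh H; rewrite unf_foldl IH.
- move=> c IH a s IHs sg rh H; have [H' [E1 E2]] := Hn _ _ H.
  by rewrite IH // E1 E2 unf_scat_seq IHs // inst_repl.
- by move=> t IH sg rh H; rewrite IH.
- by move=> t IH s IHs sg rh H; rewrite IH ?IHs.
Qed.

Lemma unf_ren :
  (forall t f g, unf_t (ren_t f g t) = ren_t f g (unf_t t)) /\
  (forall c f g, unf_c (ren_c f g c) = ren_c f g (unf_c c)).
Proof.
have Ev f : unf_v (vren f) = vren f by [].
have En g : unf_n (nren g) = nren g by [].
have [||Ht [Hc _]] := @unf_inst_gen (fun sg rh => exists f g, sg = vren f /\ rh = nren g).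
- move=> _ _ [f] [g] [-> ->]; rewrite lift_vv_ren; split; last by split.
  by exists (upr f), g.
- move=> _ _ [f] [g] [-> ->]; rewrite lift_nn_ren; split; last by split.
  by exists f, (upr g).
split=> [t|c] f g.
  by rewrite !ren_inst.1 Ht //; exists f, g.
by rewrite !ren_inst.2.1 Hc //; exists f, g.
Qed.

Lemma unf_inst :
  (forall t sg rh, unf_t (inst_t sg rh t) = inst_t (unf_v sg) (unf_n rh) (unf_t t)) /\
  (forall c sg rh, unf_c (inst_c sg rh c) = inst_c (unf_v sg) (unf_n rh) (unf_c c)).
Proof.
have [||Ht [Hc _]] := @unf_inst_gen (fun _ _ => True).
- move=> sg rh _; split=> //; split; apply: functional_extensionality.
    by case=> //= x; rewrite /unf_v /= unf_ren.1.
  move=> a; rewrite /unf_n /lift_vn -!map_comp; congr (_, _).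
  by apply: eq_map => t /=; rewrite unf_ren.1.
- move=> sg rh _; split=> //; split; apply: functional_extensionality.
    by move=> x; rewrite /unf_v /lift_nv unf_ren.1.
  case=> //= a; rewrite /unf_n /= -!map_comp; congr (_, _).
  by apply: eq_map => t /=; rewrite unf_ren.1.
by split=> *; [apply: Ht | apply: Hc].
Qed.

Lemma unf_subst u t : unf_t (subst_t 0 u t) = subst_t 0 (unf_t u) (unf_t t).
Proof.
rewrite !subst_inst.1 unf_inst.1; congr inst_t.
by apply: functional_extensionality => -[].
Qed.

Lemma unf_repl a s c : unf_c (repl_c 0 a s c) = repl_c 0 a (unf_s s) (unf_c c).
Proof.
rewrite !repl_inst.2.1 unf_inst.2; congr inst_c.
by apply: functional_extensionality => -[|b] //; rewrite /unf_n /nrepl /= seq_of_unf.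
Qed.

(** * Parallel reduction *)

(* Explicit operators are only traversed: this relation is used on unfoldings. *)
Inductive par_t : term -> term -> Prop :=
  | P_Var x : par_t (Var x) (Var x)
  | P_App t t' u u' : par_t t t' -> par_t u u' -> par_t (App t u) (App t' u')
  | P_Lam t t' : par_t t t' -> par_t (Lam t) (Lam t')
  | P_Mu c c' : par_c c c' -> par_t (Mu c) (Mu c')
  | P_ESub t t' u u' : par_t t t' -> par_t u u' -> par_t (ESub t u) (ESub t' u')
  | P_beta t t' u u' : par_t t t' -> par_t u u' ->
      par_t (App (Lam t) u) (subst_t 0 u' t')
  | P_mu c c' u u' : par_c c c' -> par_t u u' ->
      par_t (App (Mu c) u) (Mu (mu_repl u' c'))
with par_c : command -> command -> Prop :=
  | P_Named a t t' : par_t t t' -> par_c (Named a t) (Named a t')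
  | P_ERepl c c' a s s' : par_c c c' -> par_s s s' -> par_c (ERepl c a s) (ERepl c' a s')
with par_s : stack -> stack -> Prop :=
  | P_SOne t t' : par_t t t' -> par_s (SOne t) (SOne t')
  | P_SCons t t' s s' : par_t t t' -> par_s s s' -> par_s (SCons t s) (SCons t' s').

Scheme par_t_mut := Induction for par_t Sort Prop
  with par_c_mut := Induction for par_c Sort Prop
  with par_s_mut := Induction for par_s Sort Prop.
Combined Scheme par_ind from par_t_mut, par_c_mut, par_s_mut.

#[local] Hint Constructors par_t par_c par_s : core.

Lemma par_refl :
  (forall t, par_t t t) /\ (forall c, par_c c c) /\ (forall s, par_s s s).
Proof. by apply: syntax_ind; auto. Qed.

Inductive par_l : seq term -> seq term -> Prop :=
  | P_nil : par_l [::] [::]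
  | P_cons t t' l l' : par_t t t' -> par_l l l' -> par_l (t :: l) (t' :: l').

#[local] Hint Constructors par_l : core.

Lemma par_l_map f l l' :
  (forall t t', par_t t t' -> par_t (f t) (f t')) -> par_l l l' -> par_l (map f l) (map f l').
Proof. by move=> H; elim=> //= *; auto. Qed.

Lemma par_foldl t t' l l' :
  par_t t t' -> par_l l l' -> par_t (foldl App t l) (foldl App t' l').
Proof. by move=> Ht Hl; elim: Hl t t' Ht => //= *; auto. Qed.

Lemma par_scat_seq s s' l l' :
  par_s s s' -> par_l l l' -> par_s (scat_seq s l) (scat_seq s' l').
Proof.
move=> Hs Hl; elim: Hs => [t t' Ht|t t' s0 s0' Ht _ IH] /=; last by constructor.
by elim: Hl t t' Ht => //= *; auto.
Qed.

Definition par_v (sg sg' : nat -> term) := forall x, par_t (sg x) (sg' x).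
Definition par_n (rh rh' : nat -> nat * seq term) :=
  forall a, (rh a).1 = (rh' a).1 /\ par_l (rh a).2 (rh' a).2.

(** [R] is first equality of renamings, which yields [par_ren], and then the full relation on maps,
    whose stability under lifting rests on [par_ren]. *)
Lemma par_inst_gen
  (R : (nat -> term) -> (nat -> term) -> (nat -> nat * seq term) ->
       (nat -> nat * seq term) -> Prop) :
  (forall sg sg' rh rh', R sg sg' rh rh' -> par_v sg sg' /\ par_n rh rh') ->
  (forall sg sg' rh rh', R sg sg' rh rh' ->
     R (lift_vv sg) (lift_vv sg') (lift_vn rh) (lift_vn rh') /\
     R (lift_nv sg) (lift_nv sg') (lift_nn rh) (lift_nn rh')) ->
  (forall t t', par_t t t' -> forall sg sg' rh rh', R sg sg' rh rh' ->
     par_t (inst_t sg rh t) (inst_t sg' rh' t')) /\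
  (forall c c', par_c c c' -> forall sg sg' rh rh', R sg sg' rh rh' ->
     par_c (inst_c sg rh c) (inst_c sg' rh' c')) /\
  (forall s s', par_s s s' -> forall sg sg' rh rh', R sg sg' rh rh' ->
     par_s (inst_s sg rh s) (inst_s sg' rh' s')).
Proof.
move=> Hp Hl.
have Hv sg sg' rh rh' H := (Hl sg sg' rh rh' H).1.
have Hn sg sg' rh rh' H := (Hl sg sg' rh rh' H).2.
apply: par_ind => /=; auto.
- by move=> x sg sg' rh rh' /Hp [].
- move=> t t' u u' _ IH _ IHu sg sg' rh rh' H; rewrite inst_subst; auto.
- move=> c c' u u' _ IH _ IHu sg sg' rh rh' H; rewrite inst_mu_repl; auto.
- move=> a t t' _ IH sg sg' rh rh' H; have [_ /(_ a) [-> Hr]] := Hp _ _ _ _ H.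
  by constructor; apply: par_foldl; auto.
- move=> c c' a s s' _ IH _ IHs sg sg' rh rh' H; have [_ /(_ a) [-> Hr]] := Hp _ _ _ _ H.
  by constructor; auto; apply: par_scat_seq; auto.
Qed.

Lemma par_ren t t' f g : par_t t t' -> par_t (ren_t f g t) (ren_t f g t').
Proof.
move=> H; rewrite !ren_inst.1.
have [||Ht _] := @par_inst_gen (fun sg sg' rh rh' =>
   exists f g, [/\ sg = vren f, sg' = vren f, rh = nren g & rh' = nren g]).
- by move=> _ _ _ _ [f'] [g'] [-> -> -> ->]; split=> x //=; apply: P_Var.
- move=> _ _ _ _ [f'] [g'] [-> -> -> ->]; rewrite lift_vv_ren lift_nn_ren; split.
    by exists (upr f'), g'.
  by exists f', (upr g').
by apply: Ht => //; exists f, g.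
Qed.

Lemma par_inst :
  (forall t t', par_t t t' -> forall sg sg' rh rh', par_v sg sg' -> par_n rh rh' ->
     par_t (inst_t sg rh t) (inst_t sg' rh' t')) /\
  (forall c c', par_c c c' -> forall sg sg' rh rh', par_v sg sg' -> par_n rh rh' ->
     par_c (inst_c sg rh c) (inst_c sg' rh' c')).
Proof.
have [||Ht [Hc _]] := @par_inst_gen (fun sg sg' rh rh' => par_v sg sg' /\ par_n rh rh').
- by [].
- move=> sg sg' rh rh' [Hs Hr]; split; split.
  + by case=> [|x] //=; apply: par_ren.
  + move=> a; have [E Ha] := Hr a; split=> //=.
    by apply: par_l_map Ha => *; apply: par_ren.
  + by move=> x; apply: par_ren.
  + case=> [|a] //=; have [E Ha] := Hr a; split=> /=; first by rewrite E.
    by apply: par_l_map Ha => *; apply: par_ren.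
by split=> *; [apply: Ht | apply: Hc].
Qed.

Lemma par_subst t t' u u' :
  par_t t t' -> par_t u u' -> par_t (subst_t 0 u t) (subst_t 0 u' t').
Proof.
move=> Ht Hu; rewrite !subst_inst.1; apply: par_inst.1 => //; case=> [|x] //=.
by apply: P_Var.
Qed.

Lemma par_seq_of s s' : par_s s s' -> par_l (seq_of s) (seq_of s').
Proof. by elim=> //= *; auto. Qed.

Lemma par_repl c c' a s s' :
  par_c c c' -> par_s s s' -> par_c (repl_c 0 a s c) (repl_c 0 a s' c').
Proof.
move=> Hc Hs; rewrite !repl_inst.2.1; apply: par_inst.2 => //; case=> [|b] //=.
by split=> //=; apply: par_seq_of.
Qed.

Lemma par_mu_repl c c' u u' :
  par_c c c' -> par_t u u' -> par_c (mu_repl u c) (mu_repl u' c').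
Proof.
move=> Hc Hu; rewrite !mu_repl_inst; apply: par_inst.2 => //; case=> [|b] //=.
by split=> //=; constructor=> //; apply: par_ren.
Qed.

(** Takahashi's complete development: all beta- and mu-redexes present are contracted at once, while
    explicit operators are kept as in [par_t]. *)
Fixpoint dev_t (t : term) : term :=
  match t with
  | Var x => Var x
  | App (Lam t) u => subst_t 0 (dev_t u) (dev_t t)
  | App (Mu c) u => Mu (mu_repl (dev_t u) (dev_c c))
  | App t u => App (dev_t t) (dev_t u)
  | Lam t => Lam (dev_t t)
  | Mu c => Mu (dev_c c)
  | ESub t u => ESub (dev_t t) (dev_t u)
  end
with dev_c (c : command) : command :=
  match c with
  | Named a t => Named a (dev_t t)
  | ERepl c a s => ERepl (dev_c c) a (dev_s s)
  end
with dev_s (s : stack) : stack :=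
  match s with
  | SOne t => SOne (dev_t t)
  | SCons t s => SCons (dev_t t) (dev_s s)
  end.

(** Takahashi's triangle property: whatever redexes a parallel step has left over, one more parallel
    step contracts them. *)
Lemma par_dev :
  (forall t t', par_t t t' -> par_t t' (dev_t t)) /\
  (forall c c', par_c c c' -> par_c c' (dev_c c)) /\
  (forall s s', par_s s s' -> par_s s' (dev_s s)).
Proof.
apply: par_ind => /=; auto.
- move=> t t' u u' Ht IHt Hu IHu.
  case: t Ht IHt => [x|t1 t2|t0|c0|t1 t2] Ht IHt; try by apply: P_App.
  (* [P_App] left a redex uncontracted. An abstraction only reduces to an abstraction, so the redex
     survives and is contracted now. *)
  - by inversion Ht; subst; inversion IHt; subst; apply: P_beta.
  - by inversion Ht; subst; inversion IHt; subst; apply: P_mu.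
- by move=> *; apply: par_subst.
- by move=> *; constructor; apply: par_mu_repl.
Qed.
(** * Replacement in contexts and root steps *)

Lemma upr_bump k : upr (bump k) = bump k.+1.
Proof. by apply: functional_extensionality => -[|x] //=; rewrite bumpS. Qed.

Scheme tctx_mut := Induction for tctx Sort Prop
  with cctx_mut := Induction for cctx Sort Prop
  with sctx_mut := Induction for sctx Sort Prop.
Combined Scheme ctx_ind from tctx_mut, cctx_mut, sctx_mut.

Definition repl_h h : nat -> nat -> stack -> hole_type h -> hole_type h :=
  match h with HTerm => repl_t | HCmd => repl_c end.

Lemma shift_s_shift m n m' n' s :
  shift_s m n (shift_s m' n' s) = shift_s (m + m') (n + n') s.
Proof.
rewrite /shift_s ren_comp.2.2.
by congr ren_s; apply: functional_extensionality => x /=; rewrite addnA.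
Qed.

(** A context weakened by [bump k] has no occurrence of [k], so the replacement acts at the hole
    alone, with its data weakened by the binders crossed. *)
Lemma repl_fill :
  (forall h (T : tctx h) k a s r,
     repl_t k a s (fill_t (ren_tctx id (bump k) T) r)
     = fill_t T (repl_h (nd_t T + k) (nd_t T + a) (shift_s (vd_t T) (nd_t T) s) r)) /\
  (forall h (C : cctx h) k a s r,
     repl_c k a s (fill_c (ren_cctx id (bump k) C) r)
     = fill_c C (repl_h (nd_c C + k) (nd_c C + a) (shift_s (vd_c C) (nd_c C) s) r)) /\
  (forall h (K : sctx h) k a s r,
     repl_s k a s (fill_s (ren_sctx id (bump k) K) r)
     = fill_s K (repl_h (nd_s K + k) (nd_s K + a) (shift_s (vd_s K) (nd_s K) s) r)).
Proof.
have Eb k a : (bump k a == k) = false by rewrite eq_sym (negbTE (neq_bump _ _)).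
have E0 s : shift_s 0 0 s = s by exact: ren_id.2.2.
apply: ctx_ind => //= *; rewrite_hyps.
all: rewrite ?upr_id ?upr_bump ?Eb ?E0 ?bumpK.
all: rewrite ?repl_shift.1 ?repl_shift.2.1 ?repl_shift.2.2 //.
all: by rewrite_hyps; rewrite ?shift_s_shift ?addn0 ?addn1 -?addSnnS.
Qed.

(** [repl_fill] brings the replacement to the hole, where the one occurrence sits, and [repl_shift]
    clears [t]. Linearity of [C] does not enter, so the non-linear rules are covered too. *)
Lemma N_rhsE C t a s :
  N_rhs C t a s
  = repl_c 0 a s (fill_c (ren_cctx id (bump 0) C)
      (Named (nd_c C) (ren_t id (bump (nd_c C)) t))).
Proof. by rewrite repl_fill.2.1 /= addn0 eqxx repl_shift.1. Qed.

Lemma C_rhsE C c' s' a s :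
  C_rhs C c' s' a s
  = repl_c 0 a s (fill_c (ren_cctx id (bump 0) C)
      (ERepl (ren_c id (bump (nd_c C).+1) c') (nd_c C) (ren_s id (bump (nd_c C)) s'))).
Proof. by rewrite repl_fill.2.1 /= addn0 eqxx repl_shift.2.1 repl_shift.2.2. Qed.

(** Turns a count into the form in which the rules express absence of a name; [unbump] provides the
    preimages. *)
Lemma fn_eq0 :
  (forall t k, fn_t k t = 0 -> exists t0, t = ren_t id (bump k) t0) /\
  (forall c k, fn_c k c = 0 -> exists c0, c = ren_c id (bump k) c0) /\
  (forall s k, fn_s k s = 0 -> exists s0, s = ren_s id (bump k) s0).
Proof.
have D m n : m + n = 0 -> m = 0 /\ n = 0 by case: m.
have Db a k : (a == k : nat) = 0 -> exists b, a = bump k b.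
  by case: eqP => // /eqP H _; exists (unbump k a); rewrite unbumpK.
apply: syntax_ind => /=.
- by move=> x k _; exists (Var x).
- by move=> t IH u IHu k /D[/IH[t0 ->] /IHu[u0 ->]]; exists (App t0 u0).
- by move=> t IH k /IH[t0 ->]; exists (Lam t0); rewrite /= upr_id.
- by move=> c IH k /IH[c0 ->]; exists (Mu c0); rewrite /= upr_bump.
- move=> t IH u IHu k /D[/IH[t0 ->] /IHu[u0 ->]]; exists (ESub t0 u0).
  by rewrite /= upr_id.
- by move=> a t IH k /D[/Db[b ->] /IH[t0 ->]]; exists (Named b t0).
- move=> c IH a s IHs k /D[/D[/IH[c0 ->] /Db[b ->]] /IHs[s0 ->]].
  by exists (ERepl c0 b s0); rewrite /= upr_bump.
- by move=> t IH k /IH[t0 ->]; exists (SOne t0).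
- by move=> t IH s IHs k /D[/IH[t0 ->] /IHs[s0 ->]]; exists (SCons t0 s0).
Qed.

(* [n] occurs at the root of the command and nowhere else in it. *)
Inductive occ (n : nat) : command -> Prop :=
  | OccNamed t : occ n (Named n (ren_t id (bump n) t))
  | OccERepl c s : occ n (ERepl (ren_c id (bump n.+1) c) n (ren_s id (bump n) s)).

(** A sum equal to 1 has one summand 1 and the others 0. The former is followed down to the
    occurrence, and [fn_eq0] puts the siblings into the weakened form required of the context. *)
Lemma fn_eq1 :
  (forall t k, fn_t k t = 1 -> exists (T : tctx HCmd) r,
     occ (nd_t T + k) r /\ t = fill_t (ren_tctx id (bump k) T) r) /\
  (forall c k, fn_c k c = 1 -> exists (C : cctx HCmd) r,
     occ (nd_c C + k) r /\ c = fill_c (ren_cctx id (bump k) C) r) /\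
  (forall s k, fn_s k s = 1 -> exists (K : sctx HCmd) r,
     occ (nd_s K + k) r /\ s = fill_s (ren_sctx id (bump k) K) r).
Proof.
have D0 m n : m + n = 0 -> m = 0 /\ n = 0 by case: m.
have D m n : m + n = 1 -> m = 1 /\ n = 0 \/ m = 0 /\ n = 1.
  by case: m => [|[|m]] // H; [right | left; case: H].
have Db a k : (a == k : nat) = 0 -> exists b, a = bump k b.
  by case: eqP => // /eqP H _; exists (unbump k a); rewrite unbumpK.
have Db1 a k : (a == k : nat) = 1 -> a = k by case: eqP.
have [F0t [F0c F0s]] := fn_eq0.
apply: syntax_ind => //=.
- move=> t IH u IHu k /D[[/IH[T [r [O ->]]] /F0t[u0 ->]]|[/F0t[t0 ->] /IHu[T [r [O ->]]]]].
    by exists (TAppL T u0), r.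
  by exists (TAppR t0 T), r.
- by move=> t IH k /IH[T [r [O ->]]]; exists (TLam T), r; rewrite /= upr_id.
- move=> c IH k /IH[C [r [O ->]]]; exists (TMu C), r.
  by rewrite /= upr_bump addSnnS.
- move=> t IH u IHu k /D[[/IH[T [r [O ->]]] /F0t[u0 ->]]|[/F0t[t0 ->] /IHu[T [r [O ->]]]]].
    by exists (TSubL T u0), r; rewrite /= upr_id.
  by exists (TSubR t0 T), r; rewrite /= upr_id.
- move=> a t IH k /D[[/Db1 -> /F0t[t0 ->]]|[/Db[b ->] /IH[T [r [O ->]]]]].
    by exists CBox, (Named k (ren_t id (bump k) t0)); split=> //; apply: OccNamed.
  by exists (CNamed b T), r.
(* The occurrence lies in the body, at the name [a], or in the stack; only at [a] is it at the root,
   under the empty context. *)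
- move=> c IH a s IHs k /D[[/D[[]|[]]]|[/D0[/F0c[c0 ->] /Db[b ->]] /IHs[K [r [O ->]]]]].
  + move=> /IH[C [r [O ->]]] /Db[b ->] /F0s[s0 ->].
    by exists (CReplL C b s0), r; rewrite /= upr_bump addSnnS.
  + move=> /F0c[c0 ->] /Db1 -> /F0s[s0 ->].
    exists CBox, (ERepl (ren_c id (bump k.+1) c0) k (ren_s id (bump k) s0)).
    by split=> //; apply: OccERepl.
  + by exists (CReplR c0 b K), r; rewrite /= upr_bump.
- by move=> t IH k /IH[T [r [O ->]]]; exists (SCOne T), r.
- move=> t IH s IHs k /D[[/IH[T [r [O ->]]] /F0s[s0 ->]]|[/F0t[t0 ->] /IHs[K [r [O ->]]]]].
    by exists (SCHead T s0), r.
  by exists (SCTail t0 K), r.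
Qed.

(** For a name that occurs once, [fn_eq1] exhibits the left-hand side of N or C; linearity of [C]
    merely decides between the rule and its non-linear variant. *)
Lemma repl_root c a s : root_c (ERepl c a s) (repl_c 0 a s c).
Proof.
have [/fn_eq1.2.1 [C [r [O ->]]]|] := eqVneq (fn_c 0 c) 1; last first.
  by move=> /eqP; apply: R_Rnl.
rewrite addn0 in O; case: O => [t|c' s'].
  rewrite -N_rhsE; case: (boolP (is_lcc C)) => H; [exact: R_N|exact: R_Nnl].
rewrite -C_rhsE; case: (boolP (is_lcc C)) => H; [exact: R_C|exact: R_Cnl].
Qed.

(** All five rules execute one explicit replacement, which unfolding executes anyway. *)
Lemma unf_root_c c c' : root_c c c' -> unf_c c = unf_c c'.
Proof.
have E d a s d' : repl_c 0 a s d = d' -> unf_c (ERepl d a s) = unf_c d'.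
  by move=> <-; rewrite unf_repl.
by case=> *; apply: E; rewrite ?N_rhsE ?C_rhsE.
Qed.

(** The second conjunct makes [sg] cancel the weakening of an argument that has entered [L] from
    outside. *)
Lemma unf_fill_subst_ctx (L : tctx HTerm) :
  is_subst_ctx L -> exists sg,
    (forall t, unf_t (fill_t L t) = inst_t sg (nren id) (unf_t t)) /\
    (forall x, sg (vd_t L + x) = Var x).
Proof.
(* Induction needs a general index [h], but terms fill the hole only at [HTerm]; hence a predicate
   that is trivial at [HCmd]. *)
pose P h : tctx h -> Prop := match h with
  | HTerm => fun T => exists sg,
      (forall t, unf_t (fill_t T t) = inst_t sg (nren id) (unf_t t)) /\
      (forall x, sg (vd_t T + x) = Var x)
  | HCmd => fun _ => True end.
suff H h (T : tctx h) : is_subst_ctx T -> P h T by exact: H.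
elim: T => {h} //=.
  by exists Var; split=> // t; rewrite inst_id.1.
case=> //= T IH u /IH [sg [Hf Hx]].
(* The inner context acts first; the outermost substitution is applied to its result. *)
exists (comp_vv (vsubst 0 (unf_t u)) (nren id) sg); split=> [t|x].
  by rewrite Hf subst_inst.1 inst_comp.1.
by rewrite /comp_vv addSnnS Hx /= /vsubst /= /unbump subn1.
Qed.

(** * Reflexive-transitive closure and reduction between unfoldings *)

Definition star A (R : A -> A -> Prop) := clos_refl_trans A R.

Lemma star_refl A (R : A -> A -> Prop) x : star R x x.
Proof. exact: rt_refl. Qed.

Lemma star_step A (R : A -> A -> Prop) x y : R x y -> star R x y.
Proof. exact: rt_step. Qed.

Lemma star_trans A (R : A -> A -> Prop) y x z : star R x y -> star R y z -> star R x z.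
Proof. exact: rt_trans. Qed.

Lemma star_map A B (R : A -> A -> Prop) (S : B -> B -> Prop) f :
  (forall x y, R x y -> star S (f x) (f y)) ->
  forall x y, star R x y -> star S (f x) (f y).
Proof.
move=> H x y; elim=> {x y} [x y /H //|x|x y z _ IHx _ IHy]; first exact: star_refl.
exact: star_trans IHx IHy.
Qed.

(** Once [L] has become a substitution, dB and dM are a beta- and a mu-step at the root, and [E]
    recovers the argument weakened into [L]. Rule S leaves the unfolding unchanged. *)
Lemma unf_root_t t t' : root_t t t' -> star par_t (unf_t t) (unf_t t').
Proof.
have E n sg u : (forall x, sg (n + x) = Var x) ->
    inst_t sg (nren id) (unf_t (shift_t n 0 u)) = unf_t u.
  move=> H; rewrite unf_ren.1 inst_ren.1 -[RHS]inst_id.1; congr inst_t.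
  exact: functional_extensionality.
case=> {t t'} [L t u /unf_fill_subst_ctx [sg [Hf Hx]]|t u|
               L c u /unf_fill_subst_ctx [sg [Hf Hx]]].
- rewrite Hf /= Hf /= inst_subst E //.
  by apply: star_step; apply: P_beta; apply: par_refl.1.
- by rewrite unf_subst; apply: star_refl.
- rewrite Hf /= Hf /=.
  (* Splitting off the weakening by the fresh name exposes the shape of [mu_repl]. *)
  have -> : shift_t (vd_t L) 1 u = shift_t 0 1 (shift_t (vd_t L) 0 u).
    by rewrite /shift_t ren_comp.1.
  rewrite [unf_t (shift_t 0 1 _)]unf_ren.1 unf_ren.2.
  rewrite -/(mu_repl (unf_t (shift_t (vd_t L) 0 u)) (unf_c c)) inst_mu_repl E //.
  by apply: star_step; apply: P_mu; [apply: par_refl.2.1|apply: par_refl.1].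
Qed.

Definition par_unf_h h : hole_type h -> hole_type h -> Prop :=
  match h with
  | HTerm => fun t t' => star par_t (unf_t t) (unf_t t')
  | HCmd => fun c c' => star par_c (unf_c c) (unf_c c')
  end.

(** Unfolding may copy, erase or instantiate what fills a hole next to an explicit operator;
    [par_subst] and [par_repl] still yield one parallel step for each step in the hole. *)
Lemma par_unf_fill :
  (forall h (T : tctx h) r r', par_unf_h r r' ->
     star par_t (unf_t (fill_t T r)) (unf_t (fill_t T r'))) /\
  (forall h (C : cctx h) r r', par_unf_h r r' ->
     star par_c (unf_c (fill_c C r)) (unf_c (fill_c C r'))) /\
  (forall h (K : sctx h) r r', par_unf_h r r' ->
     star par_s (unf_s (fill_s K r)) (unf_s (fill_s K r'))).
Proof.
have [rt [rc rs]] := par_refl.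
apply: ctx_ind => //= h.
- move=> T IH u r r' /IH; apply: (star_map (f := App^~ (unf_t u))) => *.
  by apply: star_step; auto.
- move=> t T IH r r' /IH; apply: (star_map (f := App (unf_t t))) => *.
  by apply: star_step; auto.
- by move=> T IH r r' /IH; apply: star_map => *; apply: star_step; auto.
- by move=> C IH r r' /IH; apply: star_map => *; apply: star_step; auto.
- move=> T IH u r r' /IH; apply: (star_map (f := subst_t 0 (unf_t u))) => *.
  by apply: star_step; apply: par_subst.
- move=> t T IH r r' /IH; apply: (star_map (f := fun u => subst_t 0 u (unf_t t))) => *.
  by apply: star_step; apply: par_subst.
- by move=> a T IH r r' /IH; apply: star_map => *; apply: star_step; auto.
- move=> C IH a s r r' /IH; apply: (star_map (f := repl_c 0 a (unf_s s))) => *.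
  by apply: star_step; apply: par_repl.
- move=> c a K IH r r' /IH; apply: (star_map (f := fun s => repl_c 0 a s (unf_c c))) => *.
  by apply: star_step; apply: par_repl.
- by move=> T IH r r' /IH; apply: star_map => *; apply: star_step; auto.
- move=> T IH s r r' /IH; apply: (star_map (f := SCons^~ (unf_s s))) => *.
  by apply: star_step; auto.
- move=> t K IH r r' /IH; apply: (star_map (f := SCons (unf_t t))) => *.
  by apply: star_step; auto.
Qed.

(** * Simulation of parallel reduction *)

(** A term is an object only as a one-element stack, so mutual inductions over the syntax need
    [step] split by sort. *)
Inductive step_t : term -> term -> Prop :=
  | StepT h (T : tctx h) r r' : root r r' -> step_t (fill_t T r) (fill_t T r').
Inductive step_c : command -> command -> Prop :=
  | StepC h (C : cctx h) r r' : root r r' -> step_c (fill_c C r) (fill_c C r').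
Inductive step_s : stack -> stack -> Prop :=
  | StepS h (K : sctx h) r r' : root r r' -> step_s (fill_s K r) (fill_s K r').

Lemma star_App t t' u u' :
  star step_t t t' -> star step_t u u' -> star step_t (App t u) (App t' u').
Proof.
move=> Ht Hu; apply: (star_trans (y := App t' u)).
  apply: (star_map (f := App^~ u)) Ht => _ _ [h T r r' H].
  exact/star_step/(StepT (TAppL T u) H).
apply: (star_map (f := App t')) Hu => _ _ [h T r r' H].
exact/star_step/(StepT (TAppR t' T) H).
Qed.

Lemma star_Lam t t' : star step_t t t' -> star step_t (Lam t) (Lam t').
Proof. by apply: star_map => _ _ [h T r r' H]; exact/star_step/(StepT (TLam T) H). Qed.

Lemma star_Mu c c' : star step_c c c' -> star step_t (Mu c) (Mu c').
Proof. by apply: star_map => _ _ [h C r r' H]; exact/star_step/(StepT (TMu C) H). Qed.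

Lemma star_ESub t t' u u' :
  star step_t t t' -> star step_t u u' -> star step_t (ESub t u) (ESub t' u').
Proof.
move=> Ht Hu; apply: (star_trans (y := ESub t' u)).
  apply: (star_map (f := ESub^~ u)) Ht => _ _ [h T r r' H].
  exact/star_step/(StepT (TSubL T u) H).
apply: (star_map (f := ESub t')) Hu => _ _ [h T r r' H].
exact/star_step/(StepT (TSubR t' T) H).
Qed.

Lemma star_Named a t t' : star step_t t t' -> star step_c (Named a t) (Named a t').
Proof. by apply: star_map => _ _ [h T r r' H]; exact/star_step/(StepC (CNamed a T) H). Qed.

Lemma star_ERepl c c' a s s' :
  star step_c c c' -> star step_s s s' -> star step_c (ERepl c a s) (ERepl c' a s').
Proof.
move=> Hc Hs; apply: (star_trans (y := ERepl c' a s)).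
  apply: (star_map (f := fun c => ERepl c a s)) Hc => _ _ [h C r r' H].
  exact/star_step/(StepC (CReplL C a s) H).
apply: (star_map (f := ERepl c' a)) Hs => _ _ [h K r r' H].
exact/star_step/(StepC (CReplR c' a K) H).
Qed.

Lemma star_SOne t t' : star step_t t t' -> star step_s (SOne t) (SOne t').
Proof. by apply: star_map => _ _ [h T r r' H]; exact/star_step/(StepS (SCOne T) H). Qed.

Lemma star_SCons t t' s s' :
  star step_t t t' -> star step_s s s' -> star step_s (SCons t s) (SCons t' s').
Proof.
move=> Ht Hs; apply: (star_trans (y := SCons t' s)).
  apply: (star_map (f := SCons^~ s)) Ht => _ _ [h T r r' H].
  exact/star_step/(StepS (SCHead T s) H).
apply: (star_map (f := SCons t')) Hs => _ _ [h K r r' H].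
exact/star_step/(StepS (SCTail t' K) H).
Qed.

#[local] Hint Resolve star_refl star_App star_Lam star_Mu star_ESub star_Named star_ERepl
  star_SOne star_SCons : core.

Lemma star_root_t t t' : root_t t t' -> star step_t t t'.
Proof. by move=> H; apply/star_step/(@StepT HTerm TBox t t' H). Qed.

Lemma star_repl c a s : star step_c (ERepl c a s) (repl_c 0 a s c).
Proof. exact/star_step/(@StepC HCmd CBox _ _ (repl_root c a s)). Qed.

Lemma star_par :
  (forall t t', par_t t t' -> star step_t t t') /\
  (forall c c', par_c c c' -> star step_c c c') /\
  (forall s s', par_s s s' -> star step_s s s').
Proof.
apply: par_ind; auto.
- move=> t t' u u' _ Ht _ Hu; apply: (star_trans (y := App (Lam t') u')); auto.
  apply: (star_trans (y := ESub t' u')); apply: star_root_t; last exact: R_S.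
  (* The empty context weakens [u'] by no binder, which is the identity. *)
  by have := @R_dB TBox t' u' isT; rewrite /= /shift_t ren_id.1.
- move=> c c' u u' _ Hc _ Hu; apply: (star_trans (y := App (Mu c') u')); auto.
  (* dM in the empty context creates the explicit replacement whose execution is [mu_repl]. *)
  apply: star_trans (star_root_t (@R_dM TBox c' u' isT)) _.
  exact/star_Mu/star_repl.
Qed.

Lemma star_unf :
  (forall t, star step_t t (unf_t t)) /\ (forall c, star step_c c (unf_c c)) /\
  (forall s, star step_s s (unf_s s)).
Proof.
apply: syntax_ind => /=; auto.
- move=> t Ht u Hu; apply: (star_trans (y := ESub (unf_t t) (unf_t u))); auto.
  exact/star_root_t/R_S.
- move=> c Hc a s Hs; apply: (star_trans (y := ERepl (unf_c c) a (unf_s s))); auto.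
  exact: star_repl.
Qed.

(** * Confluence from complete developments *)

Lemma strip A (R : A -> A -> Prop) dev x y z :
  (forall x y, R x y -> R y (dev x)) ->
  star R x z -> R x y -> exists2 w, star R y w & R z w.
Proof.
(* A fork of two single steps closes at [dev x]; such tiles are laid along the sequence. *)
move=> dev_dominates H; elim: H y => {x z} [
  x z Hz y Hy|x y Hy|x y z _ IHx _ IHy y' /IHx [w H1 /IHy [w' H2 H3]]].
- by exists (dev x); [apply: star_step|]; apply: dev_dominates.
- by exists y => //; apply: star_refl.
- by exists w' => //; apply: star_trans H1 H2.
Qed.

Lemma development_confluent A (R : A -> A -> Prop) dev x y z :
  (forall x y, R x y -> R y (dev x)) ->
  star R x y -> star R x z -> exists2 w, star R y w & star R z w.
Proof.
move=> dev_dominates H; elim: H z => {x y} [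
  x y Hy z Hz|x z Hz|x y y' _ IHx _ IHy z /IHx [w /IHy [w' H1 H2] H3]].
- by have [w H1 H2] := strip dev_dominates Hz Hy; exists w => //; apply: star_step.
- by exists z => //; apply: star_refl.
- by exists w' => //; apply: star_trans H3 H2.
Qed.

Definition par_o (o o' : obj) : Prop :=
  match o, o' with
  | OCmd c, OCmd c' => par_c c c'
  | OStack s, OStack s' => par_s s s'
  | _, _ => False
  end.
Definition dev_o (o : obj) : obj :=
  match o with OCmd c => OCmd (dev_c c) | OStack s => OStack (dev_s s) end.
Definition unf_o (o : obj) : obj :=
  match o with OCmd c => OCmd (unf_c c) | OStack s => OStack (unf_s s) end.

Lemma steps_cmd c c' : star step_c c c' -> steps (OCmd c) (OCmd c').
Proof. by apply: star_map => _ _ [h C r r' H]; exact/star_step/(Step (OCCmd C) H). Qed.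

Lemma steps_stack s s' : star step_s s s' -> steps (OStack s) (OStack s').
Proof. by apply: star_map => _ _ [h K r r' H]; exact/star_step/(Step (OCStack K) H). Qed.

Lemma steps_unf o : steps o (unf_o o).
Proof.
case: o => [c|s]; first exact/steps_cmd/star_unf.2.1.
exact/steps_stack/star_unf.2.2.
Qed.

Lemma steps_par o o' : star par_o o o' -> steps o o'.
Proof.
apply: (star_map (f := id)) => -[c|s] [c'|s'] //= H.
  exact/steps_cmd/star_par.2.1.
exact/steps_stack/star_par.2.2.
Qed.

Lemma par_unf_steps o o' : steps o o' -> star par_o (unf_o o) (unf_o o').
Proof.
apply: star_map => _ _ [h O r r' H].
have {}H : par_unf_h r r'.
  case: h {O} r r' H => /= r r' H; first exact: unf_root_t.
  by rewrite (unf_root_c H); apply: star_refl.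
case: O r r' H => {}h K r r' H /=.
  have := par_unf_fill.2.1 _ K _ _ H.
  by apply: star_map => c c' Hc; apply: star_step.
have := par_unf_fill.2.2 _ K _ _ H.
by apply: star_map => s s' Hs; apply: star_step.
Qed.

Theorem theorem4p3 (o o0 o1 : obj) :
  steps o o0 -> steps o o1 ->
  exists o' : obj, steps o0 o' /\ steps o1 o'.
Proof.
move=> /par_unf_steps H0 /par_unf_steps H1.
have dev_dom x y : par_o x y -> par_o y (dev_o x).
  by case: x y => [c|s] [c'|s'] //=; [apply: par_dev.2.1|apply: par_dev.2.2].
have [w /steps_par Hw0 /steps_par Hw1] := development_confluent dev_dom H0 H1.
(* From [o0] and [o1], unfold first, then follow the simulated parallel steps to [w]. *)
by exists w; split; [apply: star_trans Hw0|apply: star_trans Hw1]; apply: steps_unf.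
Qed.
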